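(* Let $L$, $M_0$, $P_0$ be operators of the form $X=X^{j}(\xi)\,\partial/\partial\xi^{j}$ that do not depend on $t$, with $[L,P_0]=[L,M_0]$, and put $\mathcal{L}[A]=[L,A]$. Then the operators $$P=\frac{t}{2}\sum_{m=0}^{\infty}\frac{(-1)^m}{m!(m+1)!}\left(\frac{t}{2}\right)^{1+2m}\mathcal{L}^{1+2m}[P_0],\qquad M=\sum_{m=0}^{\infty}\frac{(-1)^m}{(m!)^2}\left(\frac{t}{2}\right)^{2m}\mathcal{L}^{2m}[M_0]$$ can be rewritten in terms of $L$ as $$P=\frac{t}{2}\sum_{k=-\infty}^{\infty}\mathbf{J_{k+1}}(tL)\,P_{0}\,\mathbf{J_{k}}(tL),\qquad M=\sum_{k=-\infty}^{\infty}\mathbf{J_{k}}(tL)\,M_{0}\,\mathbf{J_{k}}(tL),$$ where $\mathbf{J_k}(tL)$ are the operator Bessel coefficients of $L$.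
   Context: The variables are $\xi=(\xi^1,\dots,\xi^N)$ ($N$ arbitrary) and $t$. Operators $X=X^{j}\,\partial/\partial\xi^{j}$ (summation over repeated indices) are first-order differential operators, $[\cdot,\cdot]$ is the commutator, and juxtaposition denotes composition of differential operators. $\mathcal{L}^{0}[A]=A$ and $\mathcal{L}^{n}[A]=[L,[L,\dots,[L,A]\dots]]$ with $L$ appearing $n$ times. The operator Bessel coefficients $\mathbf{J_m}(tX)$, $m\in\mathbb{Z}$, of an operator $X$ are the coefficients of the formal expansion $$e^{\frac{t}{2}X(z-1/z)}=\sum_{m=-\infty}^{\infty}z^{m}\,\mathbf{J_{m}}(tX),$$ where $z$ is a commuting scalar variable. All series are understood formally, as formal power series in $t$ with operator coefficients. *)

(* Defs.v *)
From HB Require Import structures.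
From mathcomp Require Import all_boot all_order all_algebra.
From mathcomp Require Import all_classical all_reals all_analysis.

Set Implicit Arguments.
Unset Strict Implicit.
Unset Printing Implicit Defensive.

Import Order.TTheory GRing.Theory Num.Theory.
Import numFieldNormedType.Exports.

Local Open Scope classical_set_scope.
Local Open Scope ring_scope.

Section SmoothFunctions.
Variables (K : numFieldType) (N : nat).
Implicit Types (U : set 'rV[K]_N) (f g : 'rV[K]_N -> K^o) (j : 'I_N).

Definition coord_vec j : 'rV[K]_N := delta_mx 0 j.

Fixpoint Ck (k : nat) U f : Prop :=
  (forall x, U x -> {for x, continuous f}) /\
  if k is k'.+1 then
    forall j, (forall x, U x -> derivable f x (coord_vec j)) /\
              Ck k' U ('D_(coord_vec j) f)
  else True.

Definition Cinf U f : Prop := forall k, Ck k U f.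

Lemma near_open U (P : 'rV[K]_N -> Prop) x : open U -> U x ->
  (forall y, U y -> P y) -> \forall y \near x, P y.
Proof.
move=> oU Ux UP; have : nbhs x U by exact: open_nbhs_nbhs.
by apply: filterS.
Qed.

Lemma eq_Ck k U f g : open U -> (forall x, U x -> f x = g x) ->
  Ck k U f -> Ck k U g.
Proof.
move=> oU; elim: k f g => [|k IH] f g fg /= [cf df].
  split=> // x Ux; rewrite /prop_for /continuous_at -(fg x Ux).
  exact: (cvg_trans (near_eq_cvg (near_open oU Ux fg)) (cf x Ux)).
split=> [x Ux|j].
  rewrite /prop_for /continuous_at -(fg x Ux).
  exact: (cvg_trans (near_eq_cvg (near_open oU Ux fg)) (cf x Ux)).
have [dfj Cfj] := df j; split=> [x Ux|].
  exact: near_eq_derivable (near_open oU Ux fg) (dfj x Ux).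
apply: IH Cfj => x Ux.
exact: near_eq_derive (near_open oU Ux fg).
Qed.

Lemma Ck_cst k U (c : K^o) : open U -> Ck k U (cst c).
Proof.
move=> oU; elim: k c => [|k IH] c /=.
  by split=> // x _; exact: cst_continuous.
split=> [x _|j]; first exact: cst_continuous.
split=> [x _|]; first exact: derivable_cst.
apply: (eq_Ck oU _ (IH 0)) => x _.
by rewrite derive_cst.
Qed.

Lemma Ck_weak k U f : Ck k.+1 U f -> Ck k U f.
Proof.
elim: k f => [|k IH] f; first by case.
move=> [cf df]; split=> // j; have [dfj Cfj] := df j.
by split=> //; exact: IH.
Qed.

Lemma CkD k U f g : open U -> Ck k U f -> Ck k U g -> Ck k U (f + g).
Proof.
move=> oU; elim: k f g => [|k IH] f g /= [cf df] [cg dg].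
  by split=> // x Ux; apply: continuousD; [exact: cf|exact: cg].
split=> [x Ux|j]; first by apply: continuousD; [exact: cf|exact: cg].
have [dfj Cfj] := df j; have [dgj Cgj] := dg j; split=> [x Ux|].
  by apply: derivableD; [exact: dfj|exact: dgj].
apply: (eq_Ck oU _ (IH _ _ Cfj Cgj)) => x Ux.
by rewrite deriveD; [|exact: dfj|exact: dgj].
Qed.

Lemma CkM k U f g : open U -> Ck k U f -> Ck k U g ->
  Ck k U (fun x => f x * g x).
Proof.
move=> oU; elim: k f g => [|k IH] f g.
  by move=> [cf _] [cg _]; split=> // x Ux; apply: continuousM; [exact: cf|exact: cg].
move=> Cf Cg; have [cf df] := Cf; have [cg dg] := Cg.
split=> [x Ux|j]; first by apply: continuousM; [exact: cf|exact: cg].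
have [dfj Cfj] := df j; have [dgj Cgj] := dg j; split=> [x Ux|].
  by apply: derivableM; [exact: dfj|exact: dgj].
apply: (eq_Ck oU _ (CkD oU (IH _ _ (Ck_weak Cf) Cgj) (IH _ _ (Ck_weak Cg) Cfj))).
by move=> x Ux; rewrite deriveM; [|exact: dfj|exact: dgj].
Qed.

Variables (U : set 'rV[K]_N).

Lemma eq_Cinf f g : open U -> (forall x, U x -> f x = g x) -> Cinf U f -> Cinf U g.
Proof. by move=> oU fg Cf k; exact: eq_Ck fg (Cf k). Qed.

Lemma Cinf_derive f j : Cinf U f -> Cinf U ('D_(coord_vec j) f).
Proof. by move=> Cf k; have [_ /(_ j)[]] := Cf k.+1. Qed.

Lemma Cinf_derivable f j x : Cinf U f -> U x -> derivable f x (coord_vec j).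
Proof. by move=> Cf Ux; have [_ /(_ j)[dfj _]] := Cf 1%N; exact: dfj. Qed.

(* A function on [U] is represented by its extension by zero to the whole
   space, so that Leibniz equality is equality on [U]. *)
Definition Cinf_pred (oU : open U) : pred ('rV[K]_N -> K^o) :=
  fun f => `[< Cinf U f /\ forall x, ~ U x -> f x = 0 >].

Lemma Cinf_submod oU : subsemimod_closed (Cinf_pred oU).
Proof.
split; [split|].
- apply/asboolP; split=> // k; exact: (@Ck_cst k U 0 oU).
- move=> f g /asboolP[Cf f0] /asboolP[Cg g0]; apply/asboolP; split.
    by move=> k; exact: CkD (Cf k) (Cg k).
  by move=> x Ux; rewrite fctE f0// g0// addr0.
- move=> a f /asboolP[Cf f0]; apply/asboolP; split.
    by move=> k; exact: CkM (Ck_cst _ a oU) (Cf k).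
  by move=> x Ux; rewrite fctE f0// scaler0.
Qed.

HB.instance Definition _ oU :=
  GRing.isSubmodClosed.Build K ('rV[K]_N -> K^o) (Cinf_pred oU) (Cinf_submod oU).

End SmoothFunctions.

Arguments coord_vec K {N} j.

Record smooth (K : numFieldType) (N : nat) (U : set 'rV[K]_N) (oU : open U) :=
  Smooth { smooth_fun :> 'rV[K]_N -> K^o ; _ : smooth_fun \in Cinf_pred oU }.

#[warning="-projection-no-head-constant"]
HB.instance Definition _ K N U oU := [isSub for @smooth_fun K N U oU].
HB.instance Definition _ K N U oU := [Choice of @smooth K N U oU by <:].
HB.instance Definition _ K N U oU :=
  [SubChoice_isSubLmodule of @smooth K N U oU by <:].

Section VectorFields.
Variables (K : numFieldType) (N : nat) (U : set 'rV[K]_N) (oU : open U).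
Local Notation V := (smooth oU).
Implicit Types (f g : V) (j : 'I_N).

Lemma smoothP f g : (forall x, U x -> f x = g x) -> f = g.
Proof.
move=> fg; apply/val_inj/funext => x /=.
have /asboolP[_ f0] := valP f; have /asboolP[_ g0] := valP g.
by have [Ux|nUx] := pselect (U x); [exact: fg|rewrite f0// g0].
Qed.

Lemma smooth_Cinf f : Cinf U f.
Proof. by have /asboolP[] := valP f. Qed.

Lemma smooth_restrict_subproof (h : 'rV[K]_N -> K^o) : Cinf U h ->
  (h \_ U : 'rV[K]_N -> K^o) \in Cinf_pred oU.
Proof.
move=> Ch; apply/asboolP; split=> [|x nUx]; last by rewrite patchN// notin_setE.
by apply: eq_Cinf Ch => // x Ux; rewrite patchT// inE.
Qed.

Definition smooth_restrict h (Ch : Cinf U h) : V :=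
  Smooth (smooth_restrict_subproof Ch).

Lemma smooth_restrictE h (Ch : Cinf U h) x : U x -> smooth_restrict Ch x = h x.
Proof. by move=> Ux; rewrite /= patchT// inE. Qed.

Lemma smooth_mul_subproof f g : Cinf U (fun x => f x * g x).
Proof. by move=> k; apply: CkM => //; exact: smooth_Cinf. Qed.

Definition smooth_mul f g : V := smooth_restrict (smooth_mul_subproof f g).

Definition partial j f : V :=
  smooth_restrict (Cinf_derive j (smooth_Cinf f)).

Definition vector_field_fun (X : 'I_N -> V) : V -> V :=
  fun f => \sum_(j < N) smooth_mul (X j) (partial j f).

Lemma vector_field_linear X : linear (vector_field_fun X).
Proof.
move=> a f g; rewrite /vector_field_fun scaler_sumr -big_split /=.
apply: eq_bigr => j _; apply: smoothP => x Ux.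
have valE (u v : V) : (a *: u + v) x = a * u x + v x by [].
have partialE u : partial j u x = 'D_(coord_vec K j) u x.
  exact: smooth_restrictE.
have mulE u v : smooth_mul u v x = u x * v x by exact: smooth_restrictE.
rewrite valE !mulE !partialE.
have df := Cinf_derivable (j := j) (smooth_Cinf f) Ux.
have dg := Cinf_derivable (j := j) (smooth_Cinf g) Ux.
have -> : 'D_(coord_vec K j) (a *: f + g) x =
    a * 'D_(coord_vec K j) f x + 'D_(coord_vec K j) g x.
  by have := deriveD (derivableZ (k := a) df) dg; rewrite deriveZ.
by rewrite mulrDr mulrCA.
Qed.

HB.instance Definition _ X :=
  GRing.isLinear.Build K V V _ (vector_field_fun X) (vector_field_linear X).

End VectorFields.

Definition endo (K : fieldType) (V : lmodType K) := {linear V -> V}.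

Section EndomorphismRing.
Variables (K : fieldType) (V : lmodType K).

HB.instance Definition _ := gen_eqMixin (endo V).
HB.instance Definition _ := gen_choiceMixin (endo V).

Implicit Types A B C : endo V.

Lemma endoP A B : (forall v, A v = B v) -> A = B.
Proof.
move=> AB; have {AB} : (A : V -> V) = B by exact/funext.
case: A B => [f [[cf1] [cf2]]] [g [[cg1] [cg2]]] /= fg.
by case: _ / fg in cg1 cg2 *; congr (GRing.Linear.Pack _);
   congr (GRing.Linear.Class _ _); congr (_ _); exact: Prop_irrelevance.
Qed.

Definition endo_zero : endo V := \0 : {linear V -> V}.
Definition endo_one : endo V := idfun : {linear V -> V}.
Definition endo_opp A : endo V := (\- A)%R : {linear V -> V}.
Definition endo_add A B : endo V := (A \+ B)%R : {linear V -> V}.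
Definition endo_scale (c : K) A : endo V := (c \*: A)%R : {linear V -> V}.
Definition endo_comp A B : endo V := (A \o B)%R : {linear V -> V}.

Lemma endo_addA : associative endo_add.
Proof. by move=> A B C; apply: endoP => v /=; rewrite addrA. Qed.
Lemma endo_addC : commutative endo_add.
Proof. by move=> A B; apply: endoP => v /=; rewrite addrC. Qed.
Lemma endo_add0 : left_id endo_zero endo_add.
Proof. by move=> A; apply: endoP => v /=; rewrite add0r. Qed.
Lemma endo_addN : left_inverse endo_zero endo_opp endo_add.
Proof. by move=> A; apply: endoP => v /=; rewrite addNr. Qed.

HB.instance Definition _ :=
  GRing.isZmodule.Build (endo V) endo_addA endo_addC endo_add0 endo_addN.

Lemma endo_compA : associative endo_comp.
Proof. by move=> A B C; apply: endoP. Qed.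
Lemma endo_comp1 : left_id endo_one endo_comp.
Proof. by move=> A; apply: endoP. Qed.
Lemma endo_1comp : right_id endo_one endo_comp.
Proof. by move=> A; apply: endoP. Qed.
Lemma endo_compDl : left_distributive endo_comp +%R.
Proof. by move=> A B C; apply: endoP. Qed.
Lemma endo_compDr : right_distributive endo_comp +%R.
Proof. by move=> A B C; apply: endoP => v /=; rewrite raddfD. Qed.

HB.instance Definition _ := GRing.Zmodule_isPzRing.Build (endo V)
  endo_compA endo_comp1 endo_1comp endo_compDl endo_compDr.

Lemma endo_scaleA a b A : endo_scale a (endo_scale b A) = endo_scale (a * b) A.
Proof. by apply: endoP => v /=; rewrite scalerA. Qed.
Lemma endo_scale1 : left_id 1 endo_scale.
Proof. by move=> A; apply: endoP => v /=; rewrite scale1r. Qed.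
Lemma endo_scaleDr : right_distributive endo_scale +%R.
Proof. by move=> a A B; apply: endoP => v /=; rewrite scalerDr. Qed.
Lemma endo_scaleDl A : {morph endo_scale^~ A : a b / a + b}.
Proof. by move=> a b; apply: endoP => v /=; rewrite scalerDl. Qed.

HB.instance Definition _ := GRing.Zmodule_isLmodule.Build K (endo V)
  endo_scaleA endo_scale1 endo_scaleDr endo_scaleDl.

Lemma endo_mulE A B v : (A * B) v = A (B v).
Proof. by []. Qed.

(* [commutator L A] is [L, A]; [iter n (commutator L) A] is its n-fold iterate. *)
Definition commutator A B : endo V := A * B - B * A.

End EndomorphismRing.

Definition vector_field (K : numFieldType) (N : nat) (U : set 'rV[K]_N)
    (oU : open U) (X : 'I_N -> smooth oU) : endo (smooth oU) :=
  vector_field_fun X : {linear smooth oU -> smooth oU}.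

(* A formal series with operator coefficients and exponents in the additive
   monoid [C] is the function [C -> endo V] of its coefficients: [C := nat] for
   power series in t, [C := nat * int] for series in t, z and z^-1. *)
Section FormalSeries.
Variables (K : fieldType) (V : lmodType K).
Implicit Types A X : endo V.

Section Exponents.
Variable C : nmodType.
Implicit Types (c : C) (F G : C -> endo V).

Definition monomial c A : C -> endo V := fun d => if d == c then A else 0.

Definition fconst A : C -> endo V := monomial 0 A.

(* The Cauchy product; [\sum_(_ \in _)] is 0 on an infinite support, so this is
   meaningful only when each coefficient is a finite sum. *)
Definition fmul F G : C -> endo V :=
  fun c => \sum_(p \in [set p : C * C | p.1 + p.2 = c]) F p.1 * G p.2.

Definition fpow F (n : nat) : C -> endo V := iter n (fmul F) (fconst 1).

Definition fsummable (I : choiceType) (F : I -> C -> endo V) : Prop :=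
  forall c, finite_set [set i | F i c != 0].

Definition fsum (I : choiceType) (F : I -> C -> endo V) : C -> endo V :=
  fun c => \sum_(i \in [set: I]) F i c.

Definition fexp F : C -> endo V := fsum (fun n : nat => (n`!%:R)^-1 *: fpow F n).

End Exponents.

(* (t / 2) X (z - 1 / z) *)
Definition bessel_exponent X : nat * int -> endo V :=
  fmul (monomial (1%N, 0) (2^-1 *: X))
       (monomial (0%N, 1) 1 - monomial (0%N, -1) 1).

(* [bessel X m] is the coefficient J_m(tX) of z^m, as a series in t. *)
Definition bessel X (m : int) : nat -> endo V :=
  fun n => fexp (bessel_exponent X) (n, m).

Definition half_t : nat -> endo V := monomial 1%N (2^-1 *: (1 : endo V)).

End FormalSeries.

Arguments half_t {K V}.

Declare Scope fseries_scope.
Delimit Scope fseries_scope with FS.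
Notation "F ** G" := (fmul F G) (at level 40, left associativity) : fseries_scope.

(* Main.v *)
Require Import Defs.
From HB Require Import structures.
From mathcomp Require Import all_boot all_order all_algebra.
From mathcomp Require Import zify ring.
From mathcomp Require Import all_classical all_reals all_analysis.

Set Implicit Arguments.
Unset Strict Implicit.
Unset Printing Implicit Defensive.

Import Order.TTheory GRing.Theory Num.Theory.
Import numFieldNormedType.Exports.

Local Open Scope classical_set_scope.
Local Open Scope ring_scope.
Local Open Scope fseries_scope.

(** Put u = z - 1/z, and write ad for the map [commutator X]. The exponential
    exp(t/2 X u) is the generating series of the J_k(tX), and at 1/z the scalar
    u becomes -u. Hence the sum over k of J_{k+s}(tX) A J_k(tX) is the
    coefficient of z^s in

      exp(t/2 u X) A exp(- t/2 u X) = exp(t/2 u ad) A,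

    that is, in the sum of the (t/2)^n u^n / n! ad^n A. The coefficient of z^s
    in u^n is (-1)^m C(n, m) when n = s + 2m and 0 otherwise, and C(n, m) / n!
    is 1 / (m! (s + m)!), which gives the series in iterated commutators. The
    shift s = 1 is the formula for P and s = 0 the one for M.

    The argument is carried out degree by degree in t, where every sum is
    finite. The coefficients of u^n are [laurent_coef]; [besselE] expresses the
    operator Bessel coefficients in terms of them. That u becomes -u at 1/z,
    with the product of powers of u, is [laurent_coef_correlation]; the
    identity between exponentials is the binomial expansion [iter_commutator].
    They combine in [bessel_adjoint_expansion], which holds for every
    endomorphism of a vector space. *)

(** * Scalars and powers in the ring of endomorphisms *)

Section EndomorphismAlgebra.
Variables (K : fieldType) (V : lmodType K).
Implicit Types (A B X : endo V) (a b : K).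

Lemma endo_scaleAl a A B : a *: (A * B) = (a *: A) * B.
Proof. by apply: endoP. Qed.

Lemma endo_scaleAr a A B : a *: (A * B) = A * (a *: B).
Proof. by apply: endoP => v; rewrite /= linearZ. Qed.

Lemma endo_exprZ a A n : (a *: A) ^+ n = a ^+ n *: A ^+ n.
Proof.
elim: n => [|n IHn]; first by rewrite !expr0 scale1r.
by rewrite !exprS IHn -endo_scaleAl -endo_scaleAr scalerA.
Qed.

Lemma endo_sumE (I : Type) (r : seq I) (F : I -> endo V) v :
  (\sum_(i <- r) F i) v = \sum_(i <- r) F i v.
Proof. by apply: (big_morph (fun A : endo V => A v)). Qed.

Lemma endo_mulrnE A n v : (A *+ n) v = A v *+ n.
Proof. by elim: n => [//|n IHn]; rewrite !mulrS -IHn. Qed.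

Lemma endo_scaleE a A v : (a *: A) v = a *: A v.
Proof. by []. Qed.

Lemma endo_exprE A n v : (A ^+ n) v = iter n A v.
Proof. by elim: n v => [//|n IHn] v; rewrite exprS endo_mulE IHn. Qed.

End EndomorphismAlgebra.

(** * Powers of the adjoint action *)

Section AdjointAction.
Variables (K : fieldType) (V : lmodType K).
Implicit Types (A B X : endo V).

Definition left_mul_fun X A := X * A.
Definition right_mul_fun X A := A * X.

Fact left_mul_linear X : linear (left_mul_fun X).
Proof. by move=> a A B; rewrite /left_mul_fun mulrDr endo_scaleAr. Qed.

Fact right_mul_linear X : linear (right_mul_fun X).
Proof. by move=> a A B; rewrite /right_mul_fun mulrDl endo_scaleAl. Qed.

HB.instance Definition _ X :=
  GRing.isLinear.Build K (endo V) (endo V) _ (left_mul_fun X)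
    (left_mul_linear X).
HB.instance Definition _ X :=
  GRing.isLinear.Build K (endo V) (endo V) _ (right_mul_fun X)
    (right_mul_linear X).

Definition left_mul X : endo (endo V) := left_mul_fun X : {linear _ -> _}.
Definition right_mul X : endo (endo V) := right_mul_fun X : {linear _ -> _}.

(** Left and right multiplication by [X] commute by associativity, and
    [commutator X] is their difference; the binomial theorem in the ring of
    endomorphisms of [endo V] therefore expands its powers. *)
Lemma iter_commutator X A n :
  iter n (commutator X) A =
  \sum_(i < n.+1) ((-1) ^+ i * 'C(n, i)%:R : K) *: (X ^+ (n - i) * A * X ^+ i).
Proof.
have lX i B : iter i (left_mul X) B = X ^+ i * B.
  elim: i => [|i IHi]; first by rewrite mul1r.
  by rewrite iterS IHi exprS -mulrA.
have rX i B : iter i (right_mul X) B = B * X ^+ i.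
  elim: i => [|i IHi]; first by rewrite mulr1.
  by rewrite iterS IHi exprSr mulrA.
have lrX : GRing.comm (left_mul X) (right_mul X).
  by apply: endoP => B; exact: mulrA.
have -> : iter n (commutator X) A = ((left_mul X - right_mul X) ^+ n) A.
  by rewrite endo_exprE; elim: n => //= n ->.
rewrite (exprBn_comm _ lrX) endo_sumE; apply: eq_bigr => i _.
have signE m (C : endo (endo V)) : (-1) ^+ m * C = (-1) ^+ m *: C.
  elim: m => [|m IHm]; first by rewrite mul1r scale1r.
  by rewrite !exprS -mulrA IHm !mulN1r scaleNr.
rewrite endo_mulrnE -mulrA signE endo_scaleE endo_mulE !endo_exprE lX rX -mulrA.
by rewrite -scaler_nat scalerA mulrC.
Qed.

End AdjointAction.

(** * Computing coefficients of formal series *)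

Lemma fsumr_seq (R : zmodType) (I : choiceType) (s : seq I) (A : set I)
    (f : I -> R) :
  uniq s -> (forall i, i \in s -> A i) ->
  (forall i, A i -> i \notin s -> f i = 0) ->
  \sum_(i \in A) f i = \sum_(i <- s) f i.
Proof.
move=> us sA f0; rewrite (fsbigE s) // big_seq_cond [RHS]big_seq.
by apply: eq_bigl => i; case: (boolP (i \in s)) => //= /sA Ai; rewrite mem_set.
Qed.

Section FormalSeriesCalculus.
Variables (K : fieldType) (V : lmodType K).
Implicit Types (A B X : endo V).

Section Exponents.
Variable C : nmodType.
Implicit Types (c : C) (F G : C -> endo V).

(** A Cauchy product is often a finite sum even when infinitely many pairs of
    exponents add up to [c], as for exponents in [nat * int]; [s] lists the
    pairs that may contribute. *)
Lemma fmul_seq F G c (s : seq (C * C)) :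
  uniq s -> (forall p, p \in s -> p.1 + p.2 = c) ->
  (forall p, p.1 + p.2 = c -> p \notin s -> F p.1 * G p.2 = 0) ->
  (F ** G) c = \sum_(p <- s) F p.1 * G p.2.
Proof. by move=> us sc s0; apply: fsumr_seq. Qed.

Lemma fsum_seq (I : choiceType) (F : I -> C -> endo V) c (s : seq I) :
  uniq s -> (forall i, i \notin s -> F i c = 0) ->
  fsum F c = \sum_(i <- s) F i c.
Proof. by move=> us s0; apply: fsumr_seq => // i _; exact: s0. Qed.

Lemma fsummable_seq (I : choiceType) (F : I -> C -> endo V) :
  (forall c, exists s : seq I, forall i, i \notin s -> F i c = 0) ->
  fsummable F.
Proof.
move=> Fs c; have [s s0] := Fs c.
apply: (@sub_finite_set _ _ [set` s]) => //= i /eqP Fi.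
by apply: contraPT (Fi) => /s0.
Qed.

Lemma fmul_monomial c d A B :
  monomial c A ** monomial d B = monomial (c + d) (A * B).
Proof.
apply/funext => e; rewrite [RHS]/monomial; case: eqP => [->|ecd].
  rewrite (@fmul_seq _ _ _ [:: (c, d)]) //= => [|p|p _].
  - by rewrite big_seq1 /monomial !eqxx.
  - by rewrite inE => /eqP ->.
  - rewrite inE /monomial; case: p => x y; rewrite xpair_eqE /=.
    by case: eqP; case: eqP; rewrite ?mul0r ?mulr0.
rewrite (@fmul_seq _ _ _ [::]) ?big_nil // => -[x y] /= xy _.
rewrite /monomial; case: eqP => [xc|]; last by rewrite mul0r.
case: eqP => [yd|]; last by rewrite mulr0.
by case: ecd; rewrite -xy xc yd.
Qed.

Lemma fpow_monomial c A n : fpow (monomial c A) n = monomial (c *+ n) (A ^+ n).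
Proof.
elim: n => [//|n IHn]; rewrite /fpow iterS -/(fpow _ n) IHn fmul_monomial.
by rewrite exprS mulrS.
Qed.

End Exponents.

Lemma fmul_natE (F G : nat -> endo V) n :
  (F ** G) n = \sum_(i < n.+1) F (n - i)%N * G i.
Proof.
pose h (i : 'I_n.+1) := ((n - i)%N, i : nat).
rewrite (@fmul_seq _ _ _ _ [seq h i | i <- enum 'I_n.+1]).
- by rewrite big_map big_enum.
- by rewrite map_inj_uniq ?enum_uniq // => i j [_ /ord_inj].
- by move=> p /mapP[i _ ->] /=; rewrite -[LHS]/(n - i + i)%N subnK // -ltnS.
move=> [x y] xy /negP[]; rewrite -[x + y]/(x + y)%N /= in xy.
have yn : (y < n.+1)%N by rewrite -xy ltnS leq_addl.
by apply/mapP; exists (Ordinal yn); rewrite ?mem_enum // /h /= -xy addnK.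
Qed.

End FormalSeriesCalculus.

(** * Coefficients of (z - 1/z)^n *)

Section LaurentCoefficients.
Variable K : comNzRingType.

(** The coefficient of z^m in (z - 1/z)^n, by the recursion that multiplication
    by z - 1/z induces on coefficients. *)
Fixpoint laurent_coef (n : nat) (m : int) : K :=
  if n is n'.+1 then laurent_coef n' (m - 1) - laurent_coef n' (m + 1)
  else (m == 0)%:R.

Lemma laurent_coef_eq0 n m : (n < `|m|)%N -> laurent_coef n m = 0.
Proof.
elim: n m => [|n IHn] m nm /=; first by case: eqP nm => // ->.
by rewrite !IHn ?subrr //; lia.
Qed.

(** The substitution of 1/z for z changes the sign of z - 1/z. *)
Lemma laurent_coefN n m : laurent_coef n (- m) = (-1) ^+ n * laurent_coef n m.
Proof.
elim: n m => [|n IHn] m /=; first by rewrite oppr_eq0 mul1r.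
rewrite (_ : - m - 1 = - (m + 1)); last by lia.
rewrite (_ : - m + 1 = - (m - 1)); last by lia.
by rewrite !IHn exprS; ring.
Qed.

(** Binomial expansion; for [n < b] both sides vanish, which lets the induction
    run over all [b]. *)
Lemma laurent_coef_bin n (b : nat) :
  laurent_coef n (n%:Z - b%:Z *+ 2) = (-1) ^+ b * 'C(n, b)%:R.
Proof.
elim: n b => [|n IHn] b /=.
  by case: b => [|b]; rewrite ?mulr1 // bin0n mulr0; case: eqP => //; lia.
rewrite (_ : n.+1%:Z - b%:Z *+ 2 - 1 = n%:Z - b%:Z *+ 2); last by lia.
rewrite IHn; case: b => [|b].
  by rewrite laurent_coef_eq0 ?subr0 ?bin0 //; lia.
rewrite (_ : n.+1%:Z - b.+1%:Z *+ 2 + 1 = n%:Z - b%:Z *+ 2); last by lia.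
by rewrite IHn binS natrD exprS; ring.
Qed.

(** Only the powers z^m with m of the same parity as n occur in
    (z - 1/z)^n. *)
Lemma laurent_coef_parity n (b : int) :
  laurent_coef n (n%:Z + 1 - b *+ 2) = 0.
Proof.
elim: n b => [|n IHn] b /=; first by case: eqP => //; lia.
rewrite (_ : n.+1%:Z + 1 - b *+ 2 - 1 = n%:Z + 1 - b *+ 2); last by lia.
rewrite (_ : n.+1%:Z + 1 - b *+ 2 + 1 = n%:Z + 1 - (b - 1) *+ 2); last by lia.
by rewrite !IHn subrr.
Qed.

(** The left-hand side is the coefficient of z^s in the product of (z - 1/z)^i
    by (w - 1/w)^j at w = 1/z, that is, by (-1)^j (z - 1/z)^j. Since the sum is
    cut off by the support of the second factor alone, induction on [i] applies
    with [r] fixed. *)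
Lemma laurent_coef_correlation (r : seq int) i j (s : int) :
  uniq r -> (forall k, k \notin r -> laurent_coef j k = 0) ->
  \sum_(k <- r) laurent_coef i (k + s) * laurent_coef j k =
  (-1) ^+ j * laurent_coef (i + j) s.
Proof.
move=> ur r0; elim: i s => [|i IHi] s.
  rewrite add0n -laurent_coefN.
  have [sr|sr] := boolP (- s \in r); last first.
    rewrite r0 // big_seq big1 // => k kr /=.
    case: eqP => ks; last by rewrite mul0r.
    by case/negP: sr; rewrite (_ : - s = k) //; lia.
  rewrite (bigD1_seq (- s)) //= addNr mul1r big1 ?addr0 // => k ks.
  by case: eqP => [|_]; [move/eqP: ks; lia|rewrite mul0r].
rewrite addSn /= mulrBr -!IHi -sumrB; apply: eq_bigr => k _.
by rewrite mulrBl !addrA addrAC.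
Qed.

End LaurentCoefficients.

(** * Operator Bessel coefficients *)

Section Bessel.
Variables (K : numFieldType) (V : lmodType K).
Implicit Types (A X : endo V).

Local Notation lc := (laurent_coef K).

Lemma bessel_exponentE X n m :
  bessel_exponent X (n, m) =
  if n == 1%N then ((m == 1)%:R - (m == -1)%:R : K) *: (2^-1 *: X) else 0.
Proof.
rewrite /bessel_exponent; case: n => [|n].
  rewrite (@fmul_seq _ _ _ _ _ _ [::]) ?big_nil // => -[[x a] [y b]] xy _.
  rewrite /monomial xpair_eqE; case: x xy => [|x] [] //= _ _.
  by rewrite mul0r.
(* The first factor is a monomial in t, so only this pair contributes. *)
rewrite (@fmul_seq _ _ _ _ _ _ [:: ((1%N, 0), (n, m))]) // => [|p|].
- rewrite big_seq1 !fctE /monomial !xpair_eqE !eqxx eqSS.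
  case: eqP => _; last by rewrite subr0 mulr0.
  rewrite scalerBl mulrBr /=.
  by case: eqP => _; case: eqP => _; rewrite ?mulr1 ?mulr0 ?scale1r ?scale0r.
- by rewrite inE => /eqP ->; congr (_, _); exact: add0r.
move=> [[x a] [y b]] [/= xy ab]; rewrite inE /monomial !xpair_eqE.
have [x1|_] := eqVneq x 1%N; last by rewrite mul0r.
have [a0|_] := eqVneq a 0; last by rewrite mul0r.
move: xy ab; rewrite x1 a0 add0r => -[<-] <-.
by rewrite add0n !eqxx.
Qed.

Lemma fmul_bessel_exponent X (G : nat * int -> endo V) k m :
  (bessel_exponent X ** G) (k, m) =
  if k is k'.+1
  then (2^-1 *: X) * (G (k', m - 1) - G (k', m + 1)) else 0.
Proof.
case: k => [|k].
  rewrite (@fmul_seq _ _ _ _ _ _ [::]) ?big_nil // => -[[x a] [y b]] xy _.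
  by rewrite bessel_exponentE; case: x xy => [|x] [] //= _ _; rewrite mul0r.
rewrite (@fmul_seq _ _ _ _ _ _
  [:: ((1%N, 1), (k, m - 1)); ((1%N, -1), (k, m + 1))]) //.
- rewrite big_cons big_seq1 !bessel_exponentE /=.
  by rewrite subr0 sub0r scale1r scaleN1r mulNr mulrBr.
- move=> p; rewrite !inE => /orP[] /eqP -> /=; congr (_, _).
    by rewrite addrC subrK.
  by rewrite addrC addrK.
move=> [[x a] [y b]] [/= xy ab]; rewrite !inE !xpair_eqE bessel_exponentE.
have [x1|_] := eqVneq x 1%N; last by rewrite mul0r.
move: xy; rewrite x1 => -[<-]; rewrite add0n !eqxx /=.
have [a1|_] := eqVneq a 1; first by rewrite -ab a1 addrC addKr eqxx.
have [a1|_] := eqVneq a (-1).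
  rewrite (_ : m + 1 = b) ?eqxx ?orbT //.
  by rewrite -ab a1 addrAC addNr add0r.
by rewrite subr0 scale0r mul0r.
Qed.

Lemma fpow_bessel_exponent X n k m :
  fpow (bessel_exponent X) n (k, m) =
  if k == n then (lc n m / 2 ^+ n) *: X ^+ n else 0.
Proof.
elim: n k m => [|n IHn] k m.
  rewrite /fpow /= /fconst /monomial xpair_eqE.
  by case: eqP => //= _; case: eqP; rewrite ?divr1 ?scale1r ?scale0r.
rewrite /fpow iterS -/(fpow _ n) fmul_bessel_exponent.
case: k => [//|k]; rewrite !IHn eqSS.
case: eqP => _; last by rewrite subr0 mulr0.
rewrite -scalerBl -endo_scaleAr -endo_scaleAl -exprS scalerA /=.
by congr (_ *: _); rewrite exprS invfM; ring.
Qed.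

(** The exponent is homogeneous of degree 1 in t, so only its n-th power
    contributes to t^n: each coefficient of the exponential is a single term. *)
Lemma besselE X m n : bessel X m n = (lc n m / (2 ^+ n * n`!%:R)) *: X ^+ n.
Proof.
rewrite /bessel /fexp (@fsum_seq _ _ _ _ _ _ [:: n]) //.
  rewrite big_seq1 fctE fpow_bessel_exponent eqxx scalerA.
  by rewrite invfM mulrC mulrA.
move=> i; rewrite inE fctE fpow_bessel_exponent eq_sym => /negPf ->.
by rewrite scaler0.
Qed.

Lemma bessel_productE X A (k l : int) n :
  (bessel X k ** fconst A ** bessel X l) n =
  \sum_(i < n.+1) (lc (n - i) k * lc i l * 'C(n, i)%:R / (2 ^+ n * n`!%:R)) *:
    (X ^+ (n - i) * A * X ^+ i).
Proof.
have fconstE i : (bessel X k ** fconst A) i = bessel X k i * A.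
  rewrite (@fmul_seq _ _ _ _ _ _ [:: (i, 0)]) ?big_seq1 /fconst /monomial //.
    by move=> p; rewrite inE => /eqP ->; exact: addr0.
  move=> [x y] /= xy; case: eqP => [y0|]; last by rewrite mulr0.
  by rewrite inE xpair_eqE y0 -xy y0 addr0 !eqxx.
rewrite fmul_natE; apply: eq_bigr => i _.
rewrite fconstE !besselE -!endo_scaleAl -!endo_scaleAr scalerA; congr (_ *: _).
have in_ : (i <= n)%N by rewrite -ltnS.
rewrite -(bin_fact in_) !natrM -[in 2 ^+ n](subnK in_) exprD.
have nz (j : nat) : (j`!%:R : K) != 0 by rewrite pnatr_eq0 -lt0n fact_gt0.
have nzC : ('C(n, i)%:R : K) != 0 by rewrite pnatr_eq0 -lt0n bin_gt0.
by field; rewrite nz nz nzC /= !expf_neq0 // pnatr_eq0.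
Qed.

(** The integers from -n to n, which contain the exponents of z in
    (z - 1/z)^j for all j <= n. *)
Definition degree_range (n : nat) : seq int :=
  [seq i%:Z - n%:Z | i <- iota 0 (2 * n).+1].

Lemma uniq_degree_range n : uniq (degree_range n).
Proof. by rewrite map_inj_uniq ?iota_uniq // => i j /addIr []. Qed.

Lemma degree_rangeP n k : k \notin degree_range n -> (n < `|k|)%N.
Proof.
apply: contraR; rewrite -leqNgt => kn; apply/mapP.
by exists (absz (k + n%:Z)); rewrite ?mem_iota; lia.
Qed.

Lemma bessel_product_eq0 X A k s n : k \notin degree_range n ->
  (bessel X (k + s) ** fconst A ** bessel X k) n = 0.
Proof.
move=> /degree_rangeP nk; rewrite bessel_productE big1 // => i _.
rewrite (laurent_coef_eq0 K (n := i)) ?mulr0 ?mul0r ?scale0r //.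
by apply: leq_ltn_trans nk; rewrite -ltnS.
Qed.

(** In the coefficient of t^n the sum over [k] acts on scalars only, where it is
    the correlation of Laurent coefficients. The sign (-1)^i that comes out is
    that of the binomial expansion of the n-th power of [commutator X]. *)
Lemma sum_bessel_product X A (s : int) n :
  fsum (fun k => bessel X (k + s) ** fconst A ** bessel X k) n =
  (lc n s / (2 ^+ n * n`!%:R)) *: iter n (commutator X) A.
Proof.
rewrite (@fsum_seq _ _ _ _ _ _ (degree_range n)) ?uniq_degree_range //; last first.
  by move=> k; exact: bessel_product_eq0.
rewrite (eq_bigr _ (fun k _ => bessel_productE X A (k + s) k n)) exchange_big.
rewrite iter_commutator scaler_sumr; apply: eq_bigr => i _.
rewrite -scaler_suml scalerA; congr (_ *: _).
have in_ : (i <= n)%N by rewrite -ltnS.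
rewrite -!mulr_suml laurent_coef_correlation ?uniq_degree_range //.
  by rewrite subnK //; ring.
move=> k /degree_rangeP nk; apply: laurent_coef_eq0; exact: leq_ltn_trans nk.
Qed.

Lemma fpow_half_t n : fpow half_t n = monomial n (2 ^- n *: (1 : endo V)).
Proof.
rewrite fpow_monomial endo_exprZ expr1n exprVn (_ : 1%N *+ n = n) //.
by elim: n => // n IHn; rewrite mulrS IHn.
Qed.

Definition adjoint_bessel_term X A (s m : nat) : nat -> endo V :=
  ((-1) ^+ m / (m`! * (s + m)`!)%:R : K) *:
    (fpow half_t (s + 2 * m)%N ** fconst (iter (s + 2 * m)%N (commutator X) A)).

(** The explicit Bessel coefficient is the coefficient of z^s in
    (z - 1/z)^n / n! for n = s + 2m: the powers z^(s+m) and (-1/z)^m are taken,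
    and C(s + 2m, m) / (s + 2m)! = 1 / (m! (s + m)!). *)
Lemma adjoint_bessel_termE X A s m n :
  adjoint_bessel_term X A s m n =
  if n == (s + 2 * m)%N
  then (lc n s%:Z / (2 ^+ n * n`!%:R)) *: iter n (commutator X) A else 0.
Proof.
rewrite /adjoint_bessel_term fpow_half_t fmul_monomial fctE /monomial addr0.
case: eqP => [->|]; last by rewrite scaler0.
rewrite -endo_scaleAl mul1r scalerA; congr (_ *: _).
rewrite (_ : s%:Z = (s + 2 * m)%N%:Z - m%:Z *+ 2); last by lia.
have mn : (m <= s + 2 * m)%N by lia.
rewrite laurent_coef_bin -(bin_fact mn).
rewrite (_ : (s + 2 * m - m = s + m)%N); last by lia.
rewrite !natrM.
have nz (j : nat) : (j`!%:R : K) != 0 by rewrite pnatr_eq0 -lt0n fact_gt0.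
have nzC : ('C(s + 2 * m, m)%:R : K) != 0 by rewrite pnatr_eq0 -lt0n bin_gt0.
by field; rewrite nz nz nzC /= expf_neq0 // pnatr_eq0.
Qed.

(** Both sides are the s-th operator Bessel coefficient of the adjoint action of
    [X], applied to [A]. In degree n, the left-hand series has a term exactly
    when n - s is a nonnegative even number; in the other degrees the Laurent
    coefficient on the right vanishes, by support or by parity. *)
Theorem bessel_adjoint_expansion X A (s : nat) :
  let F := adjoint_bessel_term X A s in
  let G (k : int) := bessel X (k + s%:Z) ** fconst A ** bessel X k in
  [/\ fsummable F, fsummable G & fsum F = fsum G].
Proof.
move=> F G.
have F0 n m : m \notin iota 0 n.+1 -> F m n = 0.
  rewrite mem_iota /F adjoint_bessel_termE; case: eqP => //; lia.
split.
- by apply: fsummable_seq => n; exists (iota 0 n.+1) => m; exact: F0.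
- apply: fsummable_seq => n; exists (degree_range n) => k.
  exact: bessel_product_eq0.
apply/funext => n; rewrite sum_bessel_product.
have [sn|sn] := boolP ((s <= n)%N && ~~ odd (n - s)); last first.
  have Fn m : F m n = 0.
    by rewrite /F adjoint_bessel_termE; case: eqP => // nE; move: sn; lia.
  rewrite (@fsum_seq _ _ _ _ _ _ [::]) ?big_nil //.
  rewrite (_ : lc n s = 0) ?mul0r ?scale0r //.
  have [ns|ns] := ltnP n s; first by apply: laurent_coef_eq0.
  rewrite (_ : s%:Z = n%:Z + 1 - ((n - s).+1)./2%:Z *+ 2) ?laurent_coef_parity //.
  by lia.
rewrite (@fsum_seq _ _ _ _ _ _ [:: (n - s)./2]) // => [|m]; last first.
  rewrite inE => /eqP mn; rewrite /F adjoint_bessel_termE.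
  by case: eqP => // nE; case: mn; lia.
by rewrite big_seq1 /F adjoint_bessel_termE; case: eqP => // nE; lia.
Qed.

End Bessel.

(** * Rewriting P and M *)

Theorem proposition3p2 (K : numFieldType) (N : nat) (U : set 'rV[K]_N)
    (oU : open U) (l m0 p0 : 'I_N -> smooth oU) :
  let L := vector_field l in
  let M0 := vector_field m0 in
  let P0 := vector_field p0 in
  let calL (n : nat) (A : endo (smooth oU)) := iter n (commutator L) A in
  let J := bessel L in
  let P_term (m : nat) : nat -> endo (smooth oU) :=
    ((-1) ^+ m / (m`! * m.+1`!)%:R : K) *:
      (fpow half_t (1 + 2 * m)%N ** fconst (calL (1 + 2 * m)%N P0)) in
  let M_term (m : nat) : nat -> endo (smooth oU) :=
    ((-1) ^+ m / (m`! ^ 2)%:R : K) *: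
      (fpow half_t (2 * m)%N ** fconst (calL (2 * m)%N M0)) in
  let P_bessel (k : int) : nat -> endo (smooth oU) :=
    J (k + 1) ** fconst P0 ** J k in
  let M_bessel (k : int) : nat -> endo (smooth oU) :=
    J k ** fconst M0 ** J k in
  let P := half_t ** fsum P_term in
  let M := fsum M_term in
  commutator L P0 = commutator L M0 ->
  [/\ fsummable P_term /\ fsummable M_term,
      fsummable P_bessel /\ P = half_t ** fsum P_bessel
    & fsummable M_bessel /\ M = fsum M_bessel].
Proof.
move=> L M0 P0 calL J P_term M_term P_bessel M_bessel P M _.
have [sPt sPb eqP] := bessel_adjoint_expansion L P0 1.
have [sMt sMb eqM] := bessel_adjoint_expansion L M0 0.
have M_besselE : M_bessel =
    fun k => bessel L (k + 0%:Z) ** fconst M0 ** bessel L k.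
  by apply/funext => k; rewrite addr0.
split; split=> //; rewrite /P /M ?M_besselE //.
by congr (_ ** _).
Qed.
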